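(* Let $\gamma>0$ and let $R_W$ be any matrix with $W=R_W^\top R_W$. Suppose $\mu\in\mathbb{R}_+$, $P\in\mathbb{S}^{n_x}_{\succ0}$, $\tilde Z\in\mathbb{S}^{n_y}_{\succ0}$, $G\in\mathbb{R}^{n_x\times n_y}$, $Y\in\mathbb{R}^{n_y\times n_a}$ satisfy $$\begin{bmatrix}P & PA-GC & PB_\omega-GD_\omega\\ * & P & 0\\ * & * & I\end{bmatrix}\succ0,\qquad \begin{bmatrix}\tilde Z & \tilde ZC & \tilde ZD_\omega\\ * & P & 0\\ * & 0 & I\end{bmatrix}\succ0,$$ $$\begin{bmatrix}\begin{bmatrix}Y^\top D_a+D_a^\top Y & D_a^\top R_W^\top\\ R_WD_a & 2\mu I\end{bmatrix} & \begin{bmatrix}\Gamma_1 & 0\\ 0 & \mu I\end{bmatrix}\\ * & \begin{bmatrix}\Gamma_2 & 0\\ 0 & \mu I\end{bmatrix}\end{bmatrix}\succeq0,$$ where $\Gamma_1=\begin{bmatrix}Y^\top C & D_a^\top G^\top & Y^\top D_\omega\end{bmatrix}$ and $\Gamma_2=\mathrm{diag}\big((2+1/\gamma)^{-1}P,\ \tfrac1\gamma P,\ \tfrac12 I\big)$. Then with $L=P^{-1}G$ and $\lambda=1/\mu$, we have $\rho(A-LC)<1$ and $$\tfrac12D_a^\top(I-CL)^\top\Sigma_{r_\omega}^{-1}(L)(I-CL)D_a-\lambda D_a^\top WD_a\succeq0.$$ Hence minimizing $\mu$ subject to these LMIs yields an approximation (a feasible point with $\lambda=1/\mu$) of the one-step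 design problem $\max_{L,\lambda\in\mathbb{R}_+}\{\lambda:\ \tfrac12D_a^\top(I-CL)^\top\Sigma_{r_\omega}^{-1}(L)(I-CL)D_a-\lambda D_a^\top WD_a\succeq0,\ \rho(A-LC)<1\}$.
   Context: System: $x(k+1)=Ax(k)+Bu(k)+B_\omega\omega(k)$, $y(k)=Cx(k)+D_\omega\omega(k)+y_a(k)$, $x\in\mathbb{R}^{n_x}$, $y\in\mathbb{R}^{n_y}$, $\omega(k)\sim\mathcal N(0,I_{n_\omega})$ i.i.d., $(A,C)$ detectable, $(A,B_\omega)$ stabilizable; observer $\hat x(k+1)=A\hat x+Bu+L(y-C\hat x)$ with residual $r=y-C\hat x$. Bias injection attack $y_a(k)=D_a\bar a$ for $k\ge0$ (zero before), with $D_a\in\mathbb{R}^{n_y\times n_a}$ having entries $(j_i,i)=1$ for compromised sensor indices $j_1<\dots<j_{n_a}$ and zeros elsewhere; $W\in\mathbb{R}^{n_y\times n_y}$ symmetric positive semidefinite. $\rho$ is spectral radius, $\mathbb{R}_+$ the positive reals, $\mathbb{S}^n_{\succ0}$ the symmetric positive definite $n\times n$ matrices, $*$ denotes blocks determined by symmetry. For stabilizing $L$, $\Sigma_{\tilde x}(L)$ solves $\Sigma=(A-LC)\Sigma(A-LC)^\top+(B_\omega-LD_\omega)(B_\omega-LD_\omega)^\top$ and $\Sigma_{r_\omega}(L)=C\Sigma_{\tilde x}(L)C^\top+D_\omega D_\omega^\top$ (assumed invertible). *)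

(* Defs.v *)
From HB Require Import structures.
From mathcomp Require Import all_boot all_order all_algebra.
From mathcomp Require Import complex.
Set Implicit Arguments. Unset Strict Implicit. Unset Printing Implicit Defensive.
Import Order.TTheory GRing.Theory Num.Theory.
Local Open Scope ring_scope.
Local Open Scope complex_scope.

Definition posdef (R : rcfType) (n : nat) (M : 'M[R]_n) : Prop :=
  M^T = M /\ forall v : 'cV[R]_n, v != 0 -> 0 < (v^T *m M *m v) 0 0.

Definition psd (R : rcfType) (n : nat) (M : 'M[R]_n) : Prop :=
  M^T = M /\ forall v : 'cV[R]_n, 0 <= (v^T *m M *m v) 0 0.

Definition spec_rad_lt1 (R : rcfType) (n : nat) (M : 'M[R]_n) : Prop :=
  forall z : R[i], eigenvalue (map_mx (fun x : R => x%:C) M) z -> `|z| < 1.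

Definition detectable (R : rcfType) (nx ny : nat) (A : 'M[R]_nx)
  (C : 'M[R]_(ny, nx)) : Prop :=
  exists L : 'M[R]_(nx, ny), spec_rad_lt1 (A - L *m C).

Definition stabilizable (R : rcfType) (nx nw : nat) (A : 'M[R]_nx)
  (B : 'M[R]_(nx, nw)) : Prop :=
  exists K : 'M[R]_(nw, nx), spec_rad_lt1 (A + B *m K).

Definition Da_of (R : rcfType) (ny na : nat) (j : 'I_na -> 'I_ny) : 'M[R]_(ny, na) :=
  \matrix_(r < ny, c < na) (if r == j c then 1 else 0).

(* Sigma solves the Lyapunov equation for the estimation error with gain L. *)
Definition lyap_sol (R : rcfType) (nx ny nw : nat) (A : 'M[R]_nx)
  (C : 'M[R]_(ny, nx)) (Bw : 'M[R]_(nx, nw)) (Dw : 'M[R]_(ny, nw))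
  (L : 'M[R]_(nx, ny)) (S : 'M[R]_nx) : Prop :=
  S = (A - L *m C) *m S *m (A - L *m C)^T
      + (Bw - L *m Dw) *m (Bw - L *m Dw)^T.

Definition sigma_r (R : rcfType) (nx ny nw : nat) (C : 'M[R]_(ny, nx))
  (Dw : 'M[R]_(ny, nw)) (S : 'M[R]_nx) : 'M[R]_ny :=
  C *m S *m C^T + Dw *m Dw^T.

Definition LMI1 (R : rcfType) (nx ny nw : nat) (A : 'M[R]_nx)
  (C : 'M[R]_(ny, nx)) (Bw : 'M[R]_(nx, nw)) (Dw : 'M[R]_(ny, nw))
  (P : 'M[R]_nx) (G : 'M[R]_(nx, ny)) : 'M[R]_(nx + nx + nw) :=
  let X := P *m A - G *m C in
  let V := col_mx (P *m Bw - G *m Dw) (0 : 'M[R]_(nx, nw)) in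
  block_mx (block_mx P X X^T P) V V^T 1%:M.

Definition LMI2 (R : rcfType) (nx ny nw : nat)
  (C : 'M[R]_(ny, nx)) (Dw : 'M[R]_(ny, nw))
  (P : 'M[R]_nx) (Z : 'M[R]_ny) : 'M[R]_(ny + nx + nw) :=
  let X := Z *m C in
  let V := col_mx (Z *m Dw) (0 : 'M[R]_(nx, nw)) in
  block_mx (block_mx Z X X^T P) V V^T 1%:M.

Definition Gamma1 (R : rcfType) (nx ny nw na : nat)
  (C : 'M[R]_(ny, nx)) (Dw : 'M[R]_(ny, nw)) (Da : 'M[R]_(ny, na))
  (G : 'M[R]_(nx, ny)) (Y : 'M[R]_(ny, na)) : 'M[R]_(na, nx + nx + nw) :=
  row_mx (row_mx (Y^T *m C) (Da^T *m G^T)) (Y^T *m Dw).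

Definition Gamma2 (R : rcfType) (nx nw : nat) (gamma : R) (P : 'M[R]_nx)
  : 'M[R]_(nx + nx + nw) :=
  block_mx (block_mx ((2 + gamma^-1)^-1 *: P) 0 0 (gamma^-1 *: P)) 0 0
           ((2^-1 : R)%:M).

Definition LMI3 (R : rcfType) (nx ny nw na m : nat)
  (C : 'M[R]_(ny, nx)) (Dw : 'M[R]_(ny, nw)) (Da : 'M[R]_(ny, na))
  (RW : 'M[R]_(m, ny)) (gamma mu : R) (P : 'M[R]_nx)
  (G : 'M[R]_(nx, ny)) (Y : 'M[R]_(ny, na))
  : 'M[R]_(na + m + (nx + nx + nw + m)) :=
  let TL := block_mx (Y^T *m Da + Da^T *m Y) (Da^T *m RW^T)
                     (RW *m Da) ((2 * mu)%:M) in
  let TR := block_mx (Gamma1 C Dw Da G Y) (0 : 'M[R]_(na, m))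
                     (0 : 'M[R]_(m, nx + nx + nw)) (mu%:M) in
  let BR := block_mx (Gamma2 nw gamma P) (0 : 'M[R]_(nx + nx + nw, m))
                     (0 : 'M[R]_(m, nx + nx + nw)) (mu%:M) in
  block_mx TL TR TR^T BR.

(* Main.v *)
Require Import Defs.
From HB Require Import structures.
From mathcomp Require Import all_boot all_order all_algebra.
From mathcomp Require Import complex ring lra.
Set Implicit Arguments. Unset Strict Implicit. Unset Printing Implicit Defensive.
Import Order.TTheory GRing.Theory Num.Theory.
Local Open Scope ring_scope.

(** Write Q = P^-1, F = A - L C and E = Bw - L Dw.  The first LMI says
    Q > F Q F^T + E E^T, so the Stein operator S |-> S - F S F^T is contractive
    in the Q-norm: this bounds the spectrum of F, makes the Lyapunov equation
    uniquely solvable and gives 0 <= S <= Q for its solution.  Evaluating the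
    third LMI at a suitable vector above each a, with d = Da a, y = Y a and
    h = (I - C L) d, yields
      mu^-1 |RW d|^2 <= 2 y^T h - 2 y^T (C Q C^T + Dw Dw^T) y
                     <= 2 y^T h - 2 y^T Sigma_r y
                     <= 1/2 h^T Sigma_r^-1 h.
    The field R is only real closed, so S is not available as a convergent
    series; the sign of S is read off a vector minimizing its Rayleigh quotient
    with respect to Q, which the complex spectral theorem provides. *)

(** * Dot product of column vectors as a bilinear form *)

Definition dotc (R : pzSemiRingType) n (x y : 'cV[R]_n) : R := (x^T *m y) 0 0.

Section Dot.
Context (R : comPzRingType).

Lemma dotcDl n (x y z : 'cV[R]_n) : dotc (x + y) z = dotc x z + dotc y z.
Proof. by rewrite /dotc linearD mulmxDl mxE. Qed.

Lemma dotcDr n (x y z : 'cV[R]_n) : dotc x (y + z) = dotc x y + dotc x z.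
Proof. by rewrite /dotc mulmxDr mxE. Qed.

Lemma dotcNl n (x y : 'cV[R]_n) : dotc (- x) y = - dotc x y.
Proof. by rewrite /dotc linearN mulNmx mxE. Qed.

Lemma dotcNr n (x y : 'cV[R]_n) : dotc x (- y) = - dotc x y.
Proof. by rewrite /dotc mulmxN mxE. Qed.

Lemma dotcZl n a (x y : 'cV[R]_n) : dotc (a *: x) y = a * dotc x y.
Proof. by rewrite /dotc linearZ -scalemxAl mxE. Qed.

Lemma dotcZr n a (x y : 'cV[R]_n) : dotc x (a *: y) = a * dotc x y.
Proof. by rewrite /dotc -scalemxAr mxE. Qed.

Lemma dotc0l n (x : 'cV[R]_n) : dotc 0 x = 0.
Proof. by rewrite /dotc trmx0 mul0mx mxE. Qed.

Lemma dotc0r n (x : 'cV[R]_n) : dotc x 0 = 0.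
Proof. by rewrite /dotc mulmx0 mxE. Qed.

Lemma dotcC n (x y : 'cV[R]_n) : dotc x y = dotc y x.
Proof. by rewrite /dotc -[in LHS](trmxK y) -trmx_mul mxE. Qed.

Lemma dotc_mull m n (A : 'M[R]_(m, n)) x y :
  dotc (A *m x) y = dotc x (A^T *m y).
Proof. by rewrite /dotc trmx_mul mulmxA. Qed.

Lemma quadE n (A : 'M[R]_n) x y : (x^T *m A *m y) 0 0 = dotc x (A *m y).
Proof. by rewrite /dotc mulmxA. Qed.

Lemma dotc_congr m n (F : 'M[R]_(m, n)) (M : 'M[R]_n) x :
  dotc x (F *m M *m F^T *m x) = dotc (F^T *m x) (M *m (F^T *m x)).
Proof. by rewrite dotc_mull trmxK !mulmxA. Qed.

Lemma dotc_col_mx m n (x1 y1 : 'cV[R]_m) (x2 y2 : 'cV[R]_n) :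
  dotc (col_mx x1 x2) (col_mx y1 y2) = dotc x1 y1 + dotc x2 y2.
Proof. by rewrite /dotc tr_col_mx mul_row_col mxE. Qed.

Definition dotcE := (dotcDl, dotcDr, dotcNl, dotcNr, dotcZl, dotcZr).
End Dot.

(** * Positive definite and semidefinite matrices *)

Section Forms.
Context (R : rcfType).

Lemma psd_dotcP n (M : 'M[R]_n) :
  psd M <-> M^T = M /\ forall v, 0 <= dotc v (M *m v).
Proof. by split=> -[sM pM]; split=> // v; move: (pM v); rewrite quadE. Qed.

Lemma posdef_dotcP n (M : 'M[R]_n) :
  posdef M <-> M^T = M /\ forall v, v != 0 -> 0 < dotc v (M *m v).
Proof. by split=> -[sM pM]; split=> // v; move: (pM v); rewrite quadE. Qed.

Lemma posdef_psd n (M : 'M[R]_n) : posdef M -> psd M.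
Proof.
move=> /posdef_dotcP[sM pM]; apply/psd_dotcP; split=> // v.
by have [->|/pM/ltW//] := eqVneq v 0; rewrite dotc0l.
Qed.

Lemma posdef_unitmx n (M : 'M[R]_n) : posdef M -> M \in unitmx.
Proof.
move=> /posdef_dotcP[sM pM]; rewrite -row_free_unit.
apply/inj_row_free => v vM0; apply/eqP; apply: contraT => v0.
have /pM : v^T != 0 by rewrite -trmx0 (inj_eq trmx_inj).
by rewrite -sM -trmx_mul vM0 trmx0 dotc0r ltxx.
Qed.

Lemma posdef_invmx n (M : 'M[R]_n) : posdef M -> posdef (invmx M).
Proof.
move=> pM; have uM := posdef_unitmx pM; case/posdef_dotcP: pM => sM pM.
apply/posdef_dotcP; split=> [|v v0]; first by rewrite trmx_inv sM.
have: invmx M *m v != 0.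
  apply: contra v0 => /eqP /(congr1 (mulmx M)); rewrite mulKVmx // mulmx0.
  by move->.
by move=> /pM; rewrite mulKVmx // dotcC.
Qed.

Lemma dotc_sq_ge0 n (x : 'cV[R]_n) : 0 <= dotc x x.
Proof.
by rewrite /dotc mxE; apply: sumr_ge0 => i _; rewrite mxE -expr2 sqr_ge0.
Qed.

Lemma psd_gram m n (A : 'M[R]_(m, n)) : psd (A *m A^T).
Proof.
apply/psd_dotcP; split=> [|v]; first by rewrite trmx_mul trmxK.
by rewrite -mulmxA -[A in A *m _]trmxK -dotc_mull dotc_sq_ge0.
Qed.

End Forms.

(** * Simultaneous diagonalization of two Hermitian forms *)

Section SimDiag.
Context (C : numClosedFieldType).
Local Open Scope sesquilinear_scope.

Lemma hermsym_spectral n (D : 'M[C]_n) : D^t* = D ->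
  exists (N : 'M[C]_n) (t : 'rV[C]_n),
    [/\ N \is unitarymx, t \is a mxOver Num.real & D = N^t* *m diag_mx t *m N].
Proof.
move=> hD; have hermD : D \is hermsymmx.
  by apply/is_hermitianmxP; rewrite expr0 scale1r hD.
exists (spectralmx D), (spectral_diag D); split.
- exact: spectral_unitarymx.
- exact: hermitian_spectral_diag_real.
- rewrite -invmx_unitary ?spectral_unitarymx //.
  exact/orthomx_spectralP/hermitian_normalmx.
Qed.

Lemma adjmxM m n p (A : 'M[C]_(m, n)) (B : 'M[C]_(n, p)) :
  (A *m B)^t* = B^t* *m A^t*.
Proof. by rewrite trmx_mul map_mxM. Qed.

(** A square root of the spectrum of [Q] gives [Q = S^t* *m S] with inverse [T] of [S]. A unitary
    [V] that diagonalizes the Hermitian matrix [T^t* *m D *m T] does not disturb [Q], so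
    [N = V *m S] serves both forms. *)
Lemma simultaneous_diag n (Q D : 'M[C]_n) : Q^t* = Q -> D^t* = D ->
  (forall v : 'cV[C]_n, v != 0 -> 0 < (v^t* *m Q *m v) 0 0) ->
  exists (N : 'M[C]_n) (t : 'rV[C]_n),
    [/\ N \in unitmx, t \is a mxOver Num.real, Q = N^t* *m N
      & D = N^t* *m diag_mx t *m N].
Proof.
move=> hQ hD pQ.
have [U [d [/unitarymxP uU dR eQ]]] := hermsym_spectral hQ.
(* The [i]-th column of [U^t*] is an eigenvector of [Q], on which the form takes the value
   [d 0 i]. *)
have d_gt0 i : 0 < d 0 i.
  have nz : U^t* *m delta_mx i 0 != 0 :> 'cV[C]_n.
    apply/eqP => /(congr1 (mulmx U)); rewrite mulmxA uU mul1mx.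
    rewrite mulmx0 => /matrixP/(_ i 0); rewrite !mxE !eqxx => /eqP.
    by rewrite oner_eq0.
  have := pQ _ nz; rewrite eQ adjmxM trmxCK !mulmxA.
  rewrite -!(mulmxA _ U) uU !mulmx1 trmx_delta map_delta_mx -rowE -colE !mxE.
  by rewrite eqxx mulr1n.
pose S := diag_mx (map_mx sqrtC d) *m U.
pose T := U^t* *m diag_mx (map_mx (fun x => (sqrtC x)^-1) d).
have ST : S *m T = 1%:M.
  rewrite /S /T mulmxA -(mulmxA _ U) uU mulmx1 mulmx_diag -diag_const_mx.
  congr diag_mx; apply/rowP => i; rewrite !mxE divff //.
  by rewrite sqrtC_eq0 gt_eqF.
have [uS _] := mulmx1_unit ST.
have eQS : Q = S^t* *m S.
  rewrite eQ /S adjmxM -!mulmxA; congr (_ *m _); rewrite mulmxA; congr (_ *m _).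
  rewrite tr_diag_mx map_diag_mx mulmx_diag; congr diag_mx.
  apply/rowP => i; rewrite !mxE /= conj_Creal; last first.
    by rewrite ger0_real // sqrtC_ge0 ltW.
  by rewrite -expr2 sqrtCK.
have hD' : (T^t* *m D *m T)^t* = T^t* *m D *m T.
  by rewrite (adjmxM _ T) (adjmxM _ D) trmxCK hD mulmxA.
have [V [t [/unitarymxP uV tR eD]]] := hermsym_spectral hD'.
have uV' : V^t* *m V = 1%:M by apply: mulmx1C.
have TS : T *m S = 1%:M by apply: mulmx1C.
have TS' : S^t* *m T^t* = 1%:M by rewrite -(adjmxM T S) TS trmx1 map_mx1.
exists (V *m S), t; split=> //.
- by rewrite unitmx_mul uS andbT; have [] := mulmx1_unit uV.
- by rewrite (adjmxM V S) eQS mulmxA -(mulmxA _ _ V) uV' mulmx1.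
- rewrite (adjmxM V S).
  transitivity (S^t* *m (V^t* *m diag_mx t *m V) *m S); last by rewrite !mulmxA.
  by rewrite -eD (mulmxA (S^t*)) (mulmxA (S^t*)) TS' mul1mx -mulmxA TS mulmx1.
Qed.
Lemma diag_form n (t : 'rV[C]_n) (w : 'cV_n) :
  (w^t* *m diag_mx t *m w) 0 0 = \sum_k t 0 k * `|w k 0| ^+ 2.
Proof.
rewrite mxE; apply: eq_bigr => k _.
by rewrite mul_mx_diag !mxE normCK; ring.
Qed.

End SimDiag.

(** Here [c] stands for the imaginary unit. The rows [x'] and [y'] are independent of [x] and [y],
    so the identity is purely algebraic and involves no conjugation. *)
Lemma herm_form_expand (K : comPzRingType) n (c : K) (M : 'M[K]_n)
  (x y : 'cV_n) (x' y' : 'rV_n) : c ^+ 2 = -1 ->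
  (x' - c *: y') *m M *m (x + c *: y) =
  x' *m M *m x + y' *m M *m y + c *: (x' *m M *m y - y' *m M *m x).
Proof.
move=> c2; rewrite !mulmxDl !mulNmx !mulmxDr -!scalemxAr -!scalemxAl scalerA.
rewrite -expr2 c2 scaleN1r opprD opprK scalerBr.
by rewrite (addrC (- _)) addrACA.
Qed.

(** * Minimum of a Rayleigh quotient over a real closed field *)

Section Rayleigh.
Context (R : rcfType).
Local Notation toC := (map_mx (real_complex R)).
Local Open Scope sesquilinear_scope.

Lemma adjmx_real m n (M : 'M[R]_(m, n)) : (toC M)^t* = toC M^T.
Proof. by apply/matrixP => i j; rewrite !mxE conj_Creal // complex_real. Qed.

(** Symmetry of [M] cancels the cross terms, so positivity passes between the real form and its
    complexification. *)
Lemma herm_form_real n (M : 'M[R]_n) (x y : 'cV[R]_n) : M^T = M ->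
  let v := toC x + 'i *: toC y in
  (v^t* *m toC M *m v) 0 0 = (dotc x (M *m x) + dotc y (M *m y))%:C%C.
Proof.
move=> sM v.
have -> : v^t* = toC x^T - 'i *: toC y^T.
  apply/matrixP => i k; rewrite !mxE rmorphD rmorphM /= conjCi.
  by rewrite !conj_Creal ?complex_real // mulNr.
rewrite /v herm_form_expand ?sqrCi // -!map_mxM [LHS]mxE mxE.
have -> : x^T *m M *m y = y^T *m M *m x.
  by apply/matrixP=> i k; rewrite !ord1 !quadE dotcC dotc_mull sM.
by rewrite subrr scaler0 [X in _ + X]mxE addr0 !mxE -rmorphD /= -!quadE !mxE.
Qed.

Lemma complex_colE n (v : 'cV[R[i]%C]_n) :
  v = toC (map_mx (@complex.Re R) v) + 'i *: toC (map_mx (@complex.Im R) v).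
Proof. by apply/colP => k; rewrite !mxE [LHS]complexE complexiE. Qed.

(** In coordinates that diagonalize both forms, the least diagonal entry [t] of [D] is the minimum
    of [D] relative to [Q]. If it is nonnegative then [D] dominates [t *: Q] and is psd; otherwise a
    real vector attaining it is extracted. *)
Lemma rayleigh_min n (Q D : 'M[R]_n) : posdef Q -> D^T = D ->
  psd D \/ exists t : R, [/\ t < 0, psd (D - t *: Q)
    & exists2 x : 'cV_n, x != 0 & dotc x ((D - t *: Q) *m x) = 0].
Proof.
(* The minimum is taken over indices, so size 0 is treated apart. *)
case: n Q D => [|n] Q D.
  move=> _ sD; left; apply/psd_dotcP; split=> // v.
  by rewrite flatmx0 dotc0l.
move=> posQ sD; have /psd_dotcP[_ q0] := posdef_psd posQ.
case/posdef_dotcP: posQ => sQ pQ.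
have [||v v0|N [t [uN tR eQ eD]]] :=
  @simultaneous_diag _ _ (toC Q) (toC D).
- by rewrite adjmx_real sQ.
- by rewrite adjmx_real sD.
- move: v0; rewrite (complex_colE v) herm_form_real //.
  set x := map_mx (@complex.Re R) _; set y := map_mx (@complex.Im R) _ => v0.
  rewrite ltcR; have [x0|/pQ x0] := eqVneq x 0; last by rewrite ltr_pwDl.
  rewrite ltr_wpDl //; apply: pQ; apply: contra v0 => /eqP ->.
  by rewrite x0 map_mx0 scaler0 addr0.
pose f k := complex.Re (t 0 k).
have tE k : t 0 k = (f k)%:C%C by rewrite /f RRe_real //; apply: (mxOverP tR).
have [i _ fi] := @Order.TotalTheory.arg_minP _ _ _ ord0 xpredT f isT.
pose M := D - f i *: Q.
have sM : M^T = M by rewrite linearB linearZ /= sQ sD.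
have eM : toC M = N^t* *m diag_mx (t - const_mx (f i)%:C%C) *m N.
  rewrite map_mxB map_mxZ /= eQ eD linearB /= diag_const_mx mulmxBr mulmxBl.
  by rewrite mul_mx_scalar -scalemxAl.
(* The weights [f k - f i] are nonnegative by minimality of [f i], and the weight at [i]
   vanishes. *)
have fM (v : 'cV_n.+1) : (v^t* *m toC M *m v) 0 0 =
    \sum_k (f k - f i)%:C%C * `|(N *m v) k 0| ^+ 2.
  rewrite eM !mulmxA -adjmxM -mulmxA diag_form.
  apply: eq_bigr => k _.
  by rewrite !mxE tE rmorphB.
have pM : psd M.
  apply/psd_dotcP; split=> // v; have := fM (toC v + 'i *: toC 0).
  rewrite herm_form_real // dotc0l addr0 -ler0c => ->.
  apply: sumr_ge0 => k _; rewrite mulr_ge0 ?exprn_ge0 //.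
  by rewrite ler0c subr_ge0 fi.
case/psd_dotcP: (pM) => _ pM'.
have [fi0|fi0] := leP 0 (f i).
  left; apply/psd_dotcP; split=> // v.
  have := pM' v; rewrite mulmxBl dotcDr dotcNr -scalemxAl dotcZr subr_ge0.
  by apply: le_trans; rewrite mulr_ge0.
right; exists (f i); split=> //.
(* The form of [M] vanishes at this complex vector. Its value is the sum of the nonnegative values
   at the real and imaginary parts, so both are zero, and one of these parts is a nonzero vector. *)
pose v := invmx N *m delta_mx i 0 : 'cV_n.+1.
have v0 : v != 0.
  apply/eqP => /(congr1 (mulmx N)); rewrite mulKVmx // mulmx0.
  by move/matrixP/(_ i 0); rewrite !mxE !eqxx => /eqP; rewrite oner_eq0.
have := fM v; rewrite mulKVmx // big1; last first.
  move=> k _; rewrite mxE andbT.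
  by have [->|_] := eqVneq k i; rewrite ?subrr ?mul0r ?normr0 ?expr0n ?mulr0.
move: v0; rewrite (complex_colE v) herm_form_real //.
set x := map_mx (@complex.Re R) _; set y := map_mx (@complex.Im R) _.
move=> v0 /complexI /eqP.
rewrite paddr_eq0 // => /andP[/eqP x0 /eqP y0].
have [ex|nx] := eqVneq x 0; last by exists x.
exists y => //; apply: contra v0 => /eqP ->.
by rewrite ex map_mx0 scaler0 addr0.
Qed.
End Rayleigh.

(** * The Stein equation: sign, uniqueness and existence of solutions *)

Section Stein.
Context (R : rcfType).

Lemma stein_psd n (Q F D : 'M[R]_n) : posdef Q ->
  posdef (Q - F *m Q *m F^T) -> D^T = D -> psd (D - F *m D *m F^T) -> psd D.
Proof.
move=> pQ /posdef_dotcP[_ pQF] sD /psd_dotcP[_ pDF].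
(* If x minimizes D/Q with value t < 0, then
   t Q(x) = D(x) >= D(F^T x) >= t Q(F^T x) > t Q(x). *)
have [//|[t [t0 /psd_dotcP[_ pDt] [x x0 eDt]]]] := rayleigh_min pQ sD.
have {}pQF := pQF _ x0; have {}pDF := pDF x; have {}pDt := pDt (F^T *m x).
move: pDF pQF pDt eDt; rewrite !mulmxBl -!scalemxAl !dotcE !dotc_congr.
nra.
Qed.

(** The quadratic form vanishes, hence by polarization the bilinear form does too; unit vectors then
    read off the entries. *)
Lemma psd_anti n (D : 'M[R]_n) : psd D -> psd (- D) -> D = 0.
Proof.
move=> /psd_dotcP[sD pD] /psd_dotcP[_ nD].
have D0 v : dotc v (D *m v) = 0.
  apply/eqP; rewrite eq_le pD; move: (nD v).
  by rewrite mulNmx dotcNr oppr_ge0 => ->.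
have D00 u v : dotc u (D *m v) = 0.
  have := D0 (u + v); rewrite mulmxDr !dotcE !D0 add0r addr0.
  rewrite [dotc v _]dotcC dotc_mull sD => /eqP.
  by rewrite -mulr2n mulrn_eq0 => /eqP.
apply/matrixP => i k; have := D00 (delta_mx i 0) (delta_mx k 0).
by rewrite /dotc trmx_delta mulmxA -rowE -colE !mxE.
Qed.

Lemma dotc_diag_block n (Q : 'M[R]_n) (x : 'cV_(n + n)) :
  dotc x (block_mx Q 0 0 Q *m x) =
  dotc (usubmx x) (Q *m usubmx x) + dotc (dsubmx x) (Q *m dsubmx x).
Proof.
by rewrite -{1 2}[x]vsubmxK mul_block_col !mul0mx addr0 add0r dotc_col_mx.
Qed.

Lemma posdef_diag_block n (Q : 'M[R]_n) : posdef Q ->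
  posdef (block_mx Q 0 0 Q).
Proof.
move=> pQ; have /psd_dotcP[_ Q0] := posdef_psd pQ.
case/posdef_dotcP: pQ => sQ pQ.
apply/posdef_dotcP; split=> [|x x0]; first by rewrite tr_block_mx sQ !trmx0.
rewrite dotc_diag_block; have [u0|/pQ u0] := eqVneq (usubmx x) 0; last first.
  by rewrite ltr_pwDl.
rewrite ltr_wpDl // pQ //; apply: contra x0 => /eqP d0.
by rewrite -[x]vsubmxK u0 d0 col_mx0.
Qed.

(* The symmetric dilation [[0, S], [S^T, 0]] reduces the uniqueness for
   arbitrary S to symmetric solutions, where stein_psd applies. *)
Lemma stein_inj n (Q F S : 'M[R]_n) : posdef Q ->
  posdef (Q - F *m Q *m F^T) -> S = F *m S *m F^T -> S = 0.
Proof.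
move=> pQ pQF eS.
pose D := block_mx 0 S S^T 0; pose F2 := block_mx F 0 0 F.
pose Q2 := block_mx Q 0 0 Q.
have eF2 : F2^T = block_mx F^T 0 0 F^T by rewrite tr_block_mx !trmx0.
have eST : S^T = F *m S^T *m F^T by rewrite {1}eS !trmx_mul trmxK mulmxA.
have eD : D = F2 *m D *m F2^T.
  by rewrite eF2 !mulmx_block !(mul0mx, mulmx0, addr0, add0r) -eST -eS.
have sD : D^T = D by rewrite tr_block_mx trmxK !trmx0.
have pQ2 : posdef Q2 by apply: posdef_diag_block.
have pQF2 : posdef (Q2 - F2 *m Q2 *m F2^T).
  rewrite eF2 !mulmx_block !(mul0mx, mulmx0, addr0, add0r).
  rewrite opp_block_mx add_block_mx !subr0; exact: posdef_diag_block.
have psd0 k : psd (0 : 'M[R]_k).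
  by apply/psd_dotcP; split=> [|v]; rewrite ?trmx0 // mul0mx dotc0r.
(* Both [D] and [- D] solve the homogeneous equation, so [stein_psd] applies to each. *)
have D0 : D = 0.
  apply: psd_anti; apply: (stein_psd pQ2 pQF2) => //.
  - by rewrite -eD subrr; apply: psd0.
  - by rewrite linearN /= sD.
  - by rewrite mulmxN mulNmx -eD subrr; apply: psd0.
have := congr1 (@ursubmx _ n n n n) D0; rewrite block_mxKur => ->.
by apply/matrixP => i k; rewrite !mxE.
Qed.

(** By [stein_inj] the Stein operator is an injective endomorphism of a finite-dimensional space,
    hence surjective. *)
Lemma stein_solvable n (Q F N : 'M[R]_n) : posdef Q ->
  posdef (Q - F *m Q *m F^T) -> exists S, S = F *m S *m F^T + N.
Proof.
move=> pQ pQF; pose f (S : 'M[R]_n) := S - F *m S *m F^T.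
have lf : linear f.
  move=> a U V; rewrite /f mulmxDr mulmxDl -scalemxAr -scalemxAl scalerBr opprD.
  by rewrite addrACA.
pose g : {linear 'M[R]_n -> 'M[R]_n} :=
  HB.pack f (GRing.isLinear.Build _ _ _ _ _ lf).
have kf : lker (linfun g) == 0%VS.
  apply/lker0P => U V; rewrite !lfunE /= /f => eUV.
  apply/eqP; rewrite -subr_eq0; apply/eqP; apply: (stein_inj pQ pQF).
  apply/eqP; rewrite -subr_eq0 mulmxBr mulmxBl; apply/eqP.
  move/eqP: eUV; rewrite -subr_eq0 => /eqP <-.
  by rewrite !opprB addrACA [RHS]addrACA; congr (_ + _); rewrite addrC.
exists ((linfun g)^-1%VF N).
have := lker0_lfunVK kf N; rewrite lfunE /= /f => {3}<-.
by rewrite addrC subrK.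
Qed.

(** [S^T - S] solves the homogeneous equation. *)
Lemma stein_sym n (Q F N S : 'M[R]_n) : posdef Q ->
  posdef (Q - F *m Q *m F^T) -> N^T = N -> S = F *m S *m F^T + N -> S^T = S.
Proof.
move=> pQ pQF sN eS; apply/eqP; rewrite -subr_eq0; apply/eqP.
apply: (stein_inj pQ pQF); rewrite mulmxBr mulmxBl.
rewrite {1 2}eS linearD /= !trmx_mul trmxK sN mulmxA.
by rewrite opprD addrACA subrr addr0.
Qed.
End Stein.

(** * From contraction in the Q-norm to the spectral radius *)

Section Spectrum.
Context (R : rcfType).

(** Eigenvectors are rows here, so [F^T] acts on the real and imaginary parts [x], [y] of [v^T] as a
    rotation scaled by the modulus of [a + i b]. The sum of their Q-forms is thus multiplied by
    [a ^+ 2 + b ^+ 2], whereas the hypothesis makes it strictly decrease. *)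
Lemma spec_rad_lt1_stein n (Q F : 'M[R]_n) : posdef Q ->
  posdef (Q - F *m Q *m F^T) -> spec_rad_lt1 F.
Proof.
move=> posQ posQF [a b] /eigenvalueP[v vF v0].
have /psd_dotcP[_ Q0] := posdef_psd posQ.
have /psd_dotcP[_ QF0] := posdef_psd posQF.
case/posdef_dotcP: posQ posQF => sQ pQ /posdef_dotcP[_ pQF].
pose x := map_mx (@complex.Re R) v^T; pose y := map_mx (@complex.Im R) v^T.
have ev : v^T = map_mx (real_complex R) x + 'i *: map_mx (real_complex R) y.
  exact: complex_colE.
have eF i : (F^T *m x) i 0 = a * x i 0 - b * y i 0 /\
            (F^T *m y) i 0 = b * x i 0 + a * y i 0.
  have := congr1 (fun M => M^T i 0)
    (vF : v *m map_mx (real_complex R) F = _); rewrite trmx_mul linearZ /= ev.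
  rewrite map_trmx mulmxDr -scalemxAr -!map_mxM !mxE -complexiE.
  move/eqP; rewrite eq_complex /=.
  rewrite !(mul0r, mul1r, mulr0, subr0, addr0, add0r).
  by case/andP=> /eqP-> /eqP->; rewrite [b * _ + _]addrC.
have xF : F^T *m x = a *: x - b *: y.
  by apply/colP => i; have [-> _] := eF i; rewrite !mxE.
have yF : F^T *m y = b *: x + a *: y.
  by apply/colP => i; have [_ ->] := eF i; rewrite !mxE.
have xy0 : (x != 0) || (y != 0).
  rewrite -negb_and; apply: contra v0 => /andP[/eqP x0 /eqP y0].
  by rewrite -[v]trmxK ev x0 y0 map_mx0 scaler0 addr0 trmx0.
have q0 : 0 < dotc x (Q *m x) + dotc y (Q *m y).
  by case/orP: xy0 => /pQ h; [rewrite ltr_pwDl | rewrite ltr_wpDl].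
have : 0 < dotc x ((Q - F *m Q *m F^T) *m x)
         + dotc y ((Q - F *m Q *m F^T) *m y).
  by case/orP: xy0 => /pQF h; [rewrite ltr_pwDl | rewrite ltr_wpDl].
rewrite !mulmxBl !dotcE !dotc_congr xF yF.
rewrite !(mulmxDr, mulmxN) -!scalemxAr !dotcE.
have -> : dotc y (Q *m x) = dotc x (Q *m y) by rewrite dotcC dotc_mull sQ.
move: q0; set p := dotc x _; set q := dotc y _; set r := dotc x _ => q0 h.
(* The terms in [r] cancel, and [h] amounts to [0 < (1 - (a ^+ 2 + b ^+ 2)) * (p + q)]. *)
have ab : a ^+ 2 + b ^+ 2 < 1 by nra.
by rewrite normc_def ltcR /= -sqrtr1 ltr_sqrt.
Qed.
End Spectrum.

(** * Consequences of the matrix inequalities *)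

Section LMIs.
Context (R : rcfType).

Lemma dotc_block m n (A : 'M[R]_m) B C (D : 'M[R]_n) x y :
  dotc (col_mx x y) (block_mx A B C D *m col_mx x y) =
  dotc x (A *m x) + dotc x (B *m y) + (dotc y (C *m x) + dotc y (D *m y)).
Proof. by rewrite mul_block_col dotc_col_mx !dotcDr. Qed.

(** This is a Schur complement: with first block [Q *m v], the other two blocks of [w] minimize the
    form, and the minimum is the form of the conclusion at [v]. *)
Lemma LMI1_stein nx nw (P F : 'M[R]_nx) (E : 'M[R]_(nx, nw)) : posdef P ->
  posdef (block_mx (block_mx P (P *m F) (P *m F)^T P) (col_mx (P *m E) 0)
    (col_mx (P *m E) (0 : 'M[R]_(nx, nw)))^T 1%:M) ->
  posdef (invmx P - F *m invmx P *m F^T - E *m E^T).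
Proof.
move=> pP /posdef_dotcP[_ pM]; have uP := posdef_unitmx pP.
case/posdef_dotcP: (pP) => sP _; case/posdef_dotcP: (posdef_invmx pP) => sQ _.
apply/posdef_dotcP; split=> [|v v0].
  by rewrite !linearB /= !trmx_mul !trmxK sQ mulmxA.
set Q := invmx P.
pose w := col_mx (col_mx (Q *m v) (- (Q *m F^T *m v))) (- (E^T *m v)).
have dP a z : dotc (Q *m a) (P *m z) = dotc a z.
  by rewrite dotc_mull sQ mulKmx.
have PQ z : P *m (Q *m z) = z :> 'cV_nx by rewrite mulKVmx.
have w0 : w != 0.
  rewrite !col_mx_eq0 !negb_and; apply/orP; left; apply/orP; left.
  apply: contra v0 => /eqP /(congr1 (mulmx P)); rewrite mulKVmx // mulmx0.
  by move=> ->.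
have := pM _ w0; rewrite !dotc_block !tr_col_mx !mul_row_col !mul_col_mx.
rewrite !dotc_col_mx !trmx_mul !trmx0 sP !mul0mx !dotc0r !addr0 mul1mx.
rewrite !mulmxN !mulmxBl !dotcE -!mulmxA !dP !PQ.
rewrite !(dotc_mull, trmxK) sQ; lra.
Qed.

Lemma LMI3_bound nx ny nw na m (C : 'M[R]_(ny, nx)) (Dw : 'M[R]_(ny, nw))
    (Da : 'M[R]_(ny, na)) (RW : 'M[R]_(m, ny)) (gamma mu : R) (P : 'M[R]_nx)
    (L : 'M[R]_(nx, ny)) (Y : 'M[R]_(ny, na)) (a : 'cV[R]_na)
    (d := Da *m a) (y := Y *m a) :
  0 < gamma -> 0 < mu -> posdef P ->
  psd (LMI3 C Dw Da RW gamma mu P (P *m L) Y) ->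
  mu^-1 * dotc (RW *m d) (RW *m d) <=
  2 * dotc y ((1%:M - C *m L) *m d)
    - 2 * dotc y ((C *m invmx P *m C^T + Dw *m Dw^T) *m y).
Proof.
move=> g0 m0 pP /psd_dotcP[_ pM]; have uP := posdef_unitmx pP.
case/posdef_dotcP: (pP) => sP _; case/posdef_dotcP: (posdef_invmx pP) => sQ _.
set Q := invmx P in sQ *.
have PQ z : P *m (Q *m z) = z :> 'cV_nx by rewrite mulKVmx.
(* Placed with opposite signs in the two blocks of size [m], [e] minimizes the form over them,
   contributing [- mu^-1 * dotc (RW *m d) (RW *m d)]. *)
pose k := Q *m (C^T *m y); pose e := mu^-1 *: (RW *m d).
(* -(2 + gamma^-1) k and -2 Dw^T y minimize over their own blocks; -k in the
   P/gamma block turns the leftover -(2 + gamma^-1) k^T P k into -2 k^T P k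
   and supplies the cross term that makes y^T (I - C L) d. *)
pose w := col_mx (col_mx a (- e))
  (col_mx (col_mx (col_mx (- ((2 + gamma^-1) *: k)) (- k))
                  (- (2 *: (Dw^T *m y)))) e).
have := pM w; rewrite /w /LMI3 /Gamma1 /Gamma2.
rewrite !dotc_block !tr_block_mx !mul_block_col !mul_row_col !tr_row_mx.
rewrite !mul_col_mx !trmx0 !mul0mx !addr0 !add0r !dotc_col_mx.
rewrite !dotc0r !addr0 !add0r !trmx_mul !trmxK !tr_scalar_mx sP.
rewrite !mul_scalar_mx !mulmxDl !mulNmx !mulmxN -!scalemxAr -!scalemxAl.
rewrite -!mulmxA !mul1mx -/d -/y -/Q -/k.
have adj p q (B : 'M[R]_(p, q)) u v : dotc u (B^T *m v) = dotc (B *m u) v.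
  by rewrite dotc_mull.
have eP : P *m k = C^T *m y by rewrite PQ.
have kP u : dotc k (P *m u) = dotc y (C *m u).
  by rewrite -[P]sP adj eP dotc_mull trmxK.
rewrite !dotcE !eP !adj -/d -/y kP.
rewrite (dotcC d y) (dotcC _ y) (dotcC (C *m k)) (dotcC (Dw *m _)) => H.
rewrite -subr_ge0; apply: (le_trans H); rewrite le_eqVlt; apply/orP; left.
by apply/eqP; field; rewrite !gt_eqF // addr_gt0 ?mulr_gt0 //.
Qed.

(** Completing the square: twice the form of [M] at [y - 2^-1 *: (invmx M *m h)] is the difference
    of the two sides. *)
Lemma psd_square_bound n (M : 'M[R]_n) (y h : 'cV_n) : psd M -> M \in unitmx ->
  2 * dotc y h - 2 * dotc y (M *m y) <= 2^-1 * dotc h (invmx M *m h).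
Proof.
move=> /psd_dotcP[sM pM] uM; have := pM (y - 2^-1 *: (invmx M *m h)).
have cross : dotc (invmx M *m h) (M *m y) = dotc y h.
  by rewrite dotcC dotc_mull sM mulKVmx.
rewrite !(mulmxDr, mulmxN) -!scalemxAr mulKVmx // !dotcE cross.
rewrite (dotcC y h) (dotcC (invmx M *m h)); lra.
Qed.

Lemma posdef_psdD n (M N : 'M[R]_n) : posdef M -> psd N -> posdef (M + N).
Proof.
move=> /posdef_dotcP[sM pM] /psd_dotcP[sN pN]; apply/posdef_dotcP.
split=> [|v v0]; first by rewrite linearD /= sM sN.
by rewrite mulmxDl dotcDr ltr_pwDl ?pM.
Qed.

End LMIs.

Theorem theorem2 (R : rcfType) (nx ny nw na m : nat)
  (A : 'M[R]_nx) (C : 'M[R]_(ny, nx))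
  (Bw : 'M[R]_(nx, nw)) (Dw : 'M[R]_(ny, nw))
  (j : 'I_na -> 'I_ny) (j_incr : forall i1 i2 : 'I_na, (i1 < i2)%N -> (j i1 < j i2)%N)
  (RW : 'M[R]_(m, ny)) (W : 'M[R]_ny) (hW : W = RW^T *m RW)
  (hdet : detectable A C) (hstab : stabilizable A Bw)
  (gamma mu : R) (hgamma : 0 < gamma) (hmu : 0 < mu)
  (P : 'M[R]_nx) (Z : 'M[R]_ny) (G : 'M[R]_(nx, ny)) (Y : 'M[R]_(ny, na))
  (hP : posdef P) (hZ : posdef Z)
  (h1 : posdef (LMI1 A C Bw Dw P G))
  (h2 : posdef (LMI2 C Dw P Z))
  (h3 : psd (LMI3 C Dw (Da_of R j) RW gamma mu P G Y)) :
  let Da := Da_of R j in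
  let L := invmx P *m G in
  let lambda := mu^-1 in
  spec_rad_lt1 (A - L *m C) /\
  (exists S : 'M[R]_nx, lyap_sol A C Bw Dw L S) /\
  (forall S : 'M[R]_nx, lyap_sol A C Bw Dw L S ->
     sigma_r C Dw S \in unitmx ->
     psd ((2^-1 : R) *: (Da^T *m (1%:M - C *m L)^T *m invmx (sigma_r C Dw S)
                          *m (1%:M - C *m L) *m Da)
          - lambda *: (Da^T *m W *m Da))).
Proof.
move=> Da L lambda.
have uP := posdef_unitmx hP; have pQ := posdef_invmx hP.
set Q := invmx P in pQ L *.
have eG : G = P *m L by rewrite mulKVmx.
(* From here on [L] enters only through [G = P *m L]. *)
clearbody L.
pose F := A - L *m C; pose E := Bw - L *m Dw.
have pQFE : posdef (Q - F *m Q *m F^T - E *m E^T).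
  apply: LMI1_stein => //; rewrite /F /E !mulmxBr !mulmxA -eG.
  exact: h1.
have pQF : posdef (Q - F *m Q *m F^T).
  by rewrite -[_ - _](subrK (E *m E^T)); apply: posdef_psdD (psd_gram E).
have sE : (E *m E^T)^T = E *m E^T by rewrite trmx_mul trmxK.
split; first exact: spec_rad_lt1_stein pQ pQF.
split=> [|S eS uS]; first exact: (stein_solvable _ pQ pQF).
have sS : S^T = S := stein_sym pQ pQF sE eS.
have sQ : Q^T = Q by case: pQ.
have eS' : S - F *m S *m F^T = E *m E^T by rewrite {1}eS addrC addKr.
have pS : psd S.
  by apply: (stein_psd pQ pQF sS); rewrite eS'; apply: psd_gram.
(* The Stein operator sends [Q - S] to [Q - F *m Q *m F^T - E *m E^T], which is positive definite by
   the first LMI. *)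
have pQS : psd (Q - S).
  apply: (stein_psd pQ pQF); first by rewrite linearB /= sQ sS.
  rewrite (mulmxBr F) (mulmxBl (F *m Q)) opprD addrACA -opprD eS'.
  exact: posdef_psd.
have sSr : (sigma_r C Dw S)^T = sigma_r C Dw S.
  by rewrite linearD /= !trmx_mul !trmxK sS mulmxA.
have sigmaE T y : dotc y ((C *m T *m C^T + Dw *m Dw^T) *m y) =
    dotc (C^T *m y) (T *m (C^T *m y)) + dotc y (Dw *m Dw^T *m y).
  by rewrite mulmxDl dotcDr dotc_congr.
have pSr : psd (sigma_r C Dw S).
  apply/psd_dotcP; split=> // y; rewrite /sigma_r sigmaE.
  case/psd_dotcP: pS => _ pS; have /psd_dotcP[_ pD] := psd_gram Dw.
  by rewrite addr_ge0.
apply/psd_dotcP; split=> [|a].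
  rewrite hW linearB !linearZ /= !trmx_mul !trmxK trmx_inv sSr.
  by rewrite !mulmxA.
rewrite eG in h3; have := LMI3_bound a hgamma hmu hP h3.
set d := _ *m a; set y := Y *m a; set h := (1%:M - _) *m d => bound.
have := psd_square_bound y h pSr uS.
have /psd_dotcP[_ /(_ (C^T *m y))] := pQS.
(* Both covariances share the term in [Dw], so comparing them at [y] reduces to [Q - S] at
   [C^T *m y]. *)
move: bound; rewrite sigmaE {1}/sigma_r sigmaE.
have -> : dotc a ((2^-1 *: (Da^T *m (1%:M - C *m L)^T *m invmx (sigma_r C Dw S)
    *m (1%:M - C *m L) *m Da) - lambda *: (Da^T *m W *m Da)) *m a) =
  2^-1 * dotc h (invmx (sigma_r C Dw S) *m h)
    - mu^-1 * dotc (RW *m d) (RW *m d).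
  by rewrite hW mulmxBl -!scalemxAl !dotcE /h /d !dotc_mull -!mulmxA.
by rewrite mulmxBl dotcDr dotcNr; lra.
Qed.
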